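(* Let $m=m_n\ge 1$ and $F=F_n=f^{(1)}\times\cdots\times f^{(m)}$ be such that $(F)_2\lesssim(F)_0$. Then, as $n\to\infty$, \[ \mathbb{P}(H^*_{nmF} \text{ is connected}) \to \begin{cases} 0 & \text{if } \log n - \frac{m}{n}(F)_1 \to +\infty,\\ 1 & \text{if } \log n - \frac{m}{n}(F)_1 \to -\infty.\end{cases} \]
   Context: Shotgun random hypergraph: given integers $n,m\ge1$ and probability distributions $f^{(1)},\dots,f^{(m)}$ on $\{0,\dots,n\}$, write $F=f^{(1)}\times\cdots\times f^{(m)}$. $H^*_{nmF}$ is the random hypergraph with node set $\{1,\dots,n\}$ and hyperedge set $\{V_1,\dots,V_m\}$ (duplicates merged), where $V_1,\dots,V_m\subset\{1,\dots,n\}$ are mutually independent and $\mathbb{P}(V_k=A)=f^{(k)}(|A|)\binom{n}{|A|}^{-1}$. A hypergraph on node set $V$ is connected if for every partition of $V$ into nonempty sets $V_1',V_2'$ some hyperedge meets both. Moments: $(F)_r=\frac1m\sum_{k=1}^m\sum_{x=2}^n x^r f^{(k)}(x)$. $a_n\lesssim b_n$ means $\limsup a_n/|b_n|<\infty$. *)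

(* Defs.v *)
From HB Require Import structures.
From mathcomp Require Import all_boot all_order all_algebra.
From mathcomp Require Import all_classical all_reals all_analysis.
Set Implicit Arguments. Unset Strict Implicit. Unset Printing Implicit Defensive.
Import Order.TTheory GRing.Theory Num.Theory.
Local Open Scope ring_scope.

(* Node set {1,...,n} is represented by 'I_n.  A profile F = f^(1) x ... x f^(m)
   is given by f : 'I_m -> nat -> R, f k x = f^(k)(x) for x in {0..n}. *)

Definition is_profile (R : realType) (n m : nat) (f : 'I_m -> nat -> R) : Prop :=
  forall k : 'I_m, (forall x, (x <= n)%N -> 0 <= f k x) /\
                   \sum_(x < n.+1) f k x = 1.

Definition edge_prob (R : realType) (n m : nat) (f : 'I_m -> nat -> R)
  (k : 'I_m) (A : {set 'I_n}) : R :=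
  f k #|A| / ('C(n, #|A|))%:R.

(* connectedness of the hypergraph on node set 'I_n with hyperedges V_1..V_m
   (merging duplicates does not change the hyperedge *set* meeting relation) *)
Definition hconnected (n m : nat) (V : {ffun 'I_m -> {set 'I_n}}) : bool :=
  [forall S : {set 'I_n},
     ((S != finset.set0) && (~: S != finset.set0)) ==>
     [exists k : 'I_m, (V k :&: S != finset.set0) && (V k :&: ~: S != finset.set0)]].

(* P(H*_{nmF} is connected), V_1..V_m mutually independent *)
Definition prob_connected (R : realType) (n m : nat) (f : 'I_m -> nat -> R) : R :=
  \sum_(V : {ffun 'I_m -> {set 'I_n}} | hconnected V)
     \prod_(k < m) edge_prob f k (V k).

Definition moment (R : realType) (n m : nat) (f : 'I_m -> nat -> R) (r : nat) : R :=
  (m%:R)^-1 * \sum_(k < m) \sum_(2 <= x < n.+1) (x%:R) ^+ r * f k x.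

(* Main.v *)
Require Import Defs.
From HB Require Import structures.
From mathcomp Require Import all_boot all_order all_algebra.
From mathcomp Require Import all_classical all_reals all_analysis.
From mathcomp Require Import ring lra zify.
Import Order.TTheory GRing.Theory Num.Theory.
Import numFieldNormedType.Exports.
Local Open Scope ring_scope.
Set Implicit Arguments.
Unset Strict Implicit.
Unset Printing Implicit Defensive.

(** Write [S_r] for [m (F)_r], so that [S_2 <= C S_0] and [2 S_0 <= S_1 <= S_2].

    If [ln n - S_1 / n -> +oo], then [S_2 / n^2 <= C ln n / n -> 0].  A node is
    isolated with probability [prod_k (1 - a_k)], where [sum_k a_k = S_1 / n] and
    [sum_k a_k^2 <= S_2 / n^2], so the mean number of isolated nodes tends to
    infinity; two nodes are isolated together with probability at most
    [exp (8 S_2 / n^2)] times the square of this product, and the second moment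
    method produces an isolated node.

    If [ln n - S_1 / n -> -oo], take the union bound over the sets [S] of at most
    [n / 2] nodes that no hyperedge crosses.  With [s = #|S|] and [y = s / n], a
    hyperedge of size [x] avoids crossing [S] with probability at most
    [y^x + (1 - y)^x].  This is at most [1 - x y + x^2 y^2], which together with
    ['C(n, s) <= (e n / s)^s] handles [C s <= n], and at most [1 - y], which
    together with ['C(n, s) <= 2^n] handles [C s > n].  In both cases the sets of
    size [s] contribute at most [r^s] for any fixed [r], once [n] is large. *)

(** * Counting sets by size, and elementary estimates *)

Lemma sum_by_card (R : realType) (n : nat) (Q : pred {set 'I_n}) (u : nat -> R) :
  \sum_(A : {set 'I_n} | Q A) u #|A| =
  \sum_(x < n.+1) u x * #|[pred A : {set 'I_n} | Q A & #|A| == x]|%:R.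
Proof.
have ltA (A : {set 'I_n}) : (#|A| < n.+1)%N by rewrite ltnS -[leqRHS]card_ord max_card.
rewrite (partition_big (fun A => Ordinal (ltA A)) xpredT) //=.
apply: eq_bigr => x _; rewrite mulr_natr -sumr_const.
apply: eq_big => [A|A /andP[_ /eqP <-]] //.
Qed.

Lemma card_noncrossing (n : nat) (S : {set 'I_n}) (x : nat) :
  (#|[pred A : {set 'I_n} | (A \subset S) || (A \subset ~: S) & #|A| == x]|
   <= 'C(#|S|, x) + 'C(n - #|S|, x))%N.
Proof.
have -> : (n - #|S|)%N = #|~: S| by rewrite [RHS]cardsCs finset.setCK card_ord.
rewrite -!cards_draws; apply: leq_trans (leq_card_setU _ _).
by rewrite -cardsE; apply/subset_leq_card/fintype.subsetP => A; rewrite !inE andb_orl.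
Qed.

(** The ratio of the two binomials is a product of factors [(s - i) / (n - i)], each at most
    [s / n]. Clearing denominators keeps the induction in [nat]. *)
Lemma bin_ratio_le (s n x : nat) : (s <= n)%N ->
  ('C(s, x) * n ^ x <= 'C(n, x) * s ^ x)%N.
Proof.
move=> sn; elim: x => [|x IH]; first by rewrite !bin0.
rewrite -(leq_pmul2l (ltn0Sn x)) !mulnA !mul_bin_left !expnS.
have -> : ((s - x) * 'C(s, x) * (n * n ^ x) = ((s - x) * n) * ('C(s, x) * n ^ x))%N by rewrite !mulnA; ring.
have -> : ((n - x) * 'C(n, x) * (s * s ^ x) = ((n - x) * s) * ('C(n, x) * s ^ x))%N by ring.
by apply: leq_mul => //; rewrite !mulnBl [(n * s)%N]mulnC leq_sub2l ?leq_mul2l ?sn ?orbT.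
Qed.

Lemma bin_ratio_ler (R : realType) (s n x : nat) : (0 < n)%N -> (s <= n)%N ->
  'C(s, x)%:R <= (s%:R / n%:R) ^+ x * 'C(n, x)%:R :> R.
Proof.
move=> n0 sn; rewrite expr_div_n mulrAC ler_pdivlMr ?exprn_gt0 ?ltr0n //.
by rewrite -!natrX -!natrM ler_nat mulnC [leqRHS]mulnC mulnC bin_ratio_le.
Qed.

(** Induction: multiplying the bound by [1 - y] leaves the slack [y^2 / 2 + x^2 y^3 / 2], which is
    nonnegative. *)
Lemma onem_expr_le (R : realType) (y : R) (x : nat) : 0 <= y <= 1 ->
  (1 - y) ^+ x <= 1 - x%:R * y + x%:R ^+ 2 * y ^+ 2 / 2.
Proof.
move=> /andP[y0 y1]; elim: x => [|x IH]; first by rewrite expr0; lra.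
rewrite exprS; apply: le_trans (ler_wpM2l _ IH) _; first lra.
rewrite -[x.+1%:R]natr1; have x0 : 0 <= x%:R :> R by [].
set z := x%:R in x0 *.
have : 0 <= z ^+ 2 * y ^+ 3 by rewrite mulr_ge0 ?exprn_ge0.
have : 0 <= y ^+ 2 by rewrite exprn_ge0.
nra.
Qed.

(** A weak Stirling bound; the induction step is [(1 + 1/s)^s <= e]. *)
Lemma factorial_ge (R : realType) (s : nat) : s%:R ^+ s <= s`!%:R * expR 1 ^+ s :> R.
Proof.
elim: s => [|s IH]; first by rewrite fact0 !expr0 mulr1.
have [->|s0] := posnP s; first by rewrite factS fact0 !expr1 muln1 mul1r (le_trans _ (expR_ge1Dx _)) ?lerDl.
have s0' : 0 < s%:R :> R by rewrite ltr0n.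
have H : s.+1%:R ^+ s <= expR 1 * s%:R ^+ s :> R.
  have -> : s.+1%:R = (1 + s%:R^-1) * s%:R :> R.
    by rewrite mulrDl mulVf ?gt_eqF // mul1r -natr1.
  rewrite exprMn ler_wpM2r ?exprn_ge0 //.
  have -> : expR 1 = expR (s%:R^-1) ^+ s :> R by rewrite -expRM_natl mulfV ?gt_eqF.
  by rewrite lerXn2r ?nnegrE ?addr_ge0 ?invr_ge0 ?expR_ge0 ?expR_ge1Dx.
rewrite exprS factS natrM exprS.
apply: le_trans (ler_wpM2l _ H) _ => //.
rewrite -!mulrA ler_wpM2l // mulrCA ler_wpM2l ?expR_ge0 //.
Qed.

Lemma big_tail (R : realType) (n : nat) (g : nat -> R) :
  \sum_(2 <= x < n.+1) g x = \sum_(x < n.+1) (if (2 <= x)%N then g x else 0).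
Proof. by rewrite (@big_nat_widenl _ _ _ 2 0) // big_mkord /= -big_mkcond. Qed.

(** * The law of one hyperedge *)

Lemma edge_prob_ge0 (R : realType) (n m : nat) (f : 'I_m -> nat -> R) k
  (A : {set 'I_n}) : is_profile n f -> 0 <= edge_prob f k A.
Proof.
move=> /(_ k)[f0 _]; rewrite divr_ge0 // f0 //.
by rewrite -[leqRHS]card_ord max_card.
Qed.

Lemma edge_probE (R : realType) (n m : nat) (f : 'I_m -> nat -> R) k
  (Q : pred {set 'I_n}) :
  \sum_(A | Q A) edge_prob f k A =
  \sum_(x < n.+1) f k x / 'C(n, x)%:R *
    #|[pred A : {set 'I_n} | Q A & #|A| == x]|%:R.
Proof. exact: (@sum_by_card R n Q (fun x => f k x / 'C(n, x)%:R)). Qed.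

(** Spreading the total mass 1 over all sizes gives this the same shape as [edge_probE], so the two
    can be compared size by size. Sizes 0 and 1 keep their full weight. *)
Lemma profile_tailE (R : realType) (n m : nat) (f : 'I_m -> nat -> R) k
  (h : nat -> R) : is_profile n f ->
  1 - \sum_(2 <= x < n.+1) h x * f k x =
  \sum_(x < n.+1) f k x / 'C(n, x)%:R *
    ((1 - if (2 <= x)%N then h x else 0) * 'C(n, x)%:R).
Proof.
move=> /(_ k)[_ f1]; rewrite -[in LHS]f1 big_tail -sumrB; apply: eq_bigr => x _.
have C0 : 'C(n, x)%:R != 0 :> R by rewrite pnatr_eq0 -lt0n bin_gt0 -ltnS.
by case: ifP => _; field.
Qed.

Lemma card_size_le (n x : nat) (Q : pred {set 'I_n}) :
  (#|[pred A : {set 'I_n} | Q A & #|A| == x]| <= 'C(n, x))%N.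
Proof.
rewrite -[in leqRHS](card_ord n) -card_draws -cardsE.
by apply/subset_leq_card/fintype.subsetP => A; rewrite !inE => /andP[].
Qed.

Lemma card_size_ge (n x : nat) (Q : pred {set 'I_n}) :
  (forall A : {set 'I_n}, #|A| = x -> Q A) ->
  ('C(n, x) <= #|[pred A : {set 'I_n} | Q A & #|A| == x]|)%N.
Proof.
move=> Qx; rewrite -[in leqLHS](card_ord n) -card_draws -cardsE.
apply/subset_leq_card/fintype.subsetP => A; rewrite !inE => /eqP Ax.
by rewrite Qx //= Ax.
Qed.

(** Given its size [x], a hyperedge is uniform among the sets of that size, so [h x] is a lower
    bound for the conditional probability that [Q] fails. Sizes below 2 get the trivial bound. *)
Lemma edge_prob_le (R : realType) (n m : nat) (f : 'I_m -> nat -> R) k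
  (Q : pred {set 'I_n}) (h : nat -> R) : is_profile n f ->
  (forall x, (2 <= x <= n)%N ->
    #|[pred A : {set 'I_n} | Q A & #|A| == x]|%:R <= (1 - h x) * 'C(n, x)%:R) ->
  \sum_(A | Q A) edge_prob f k A <= 1 - \sum_(2 <= x < n.+1) h x * f k x.
Proof.
move=> pf hQ; rewrite (profile_tailE k h pf) edge_probE; apply: ler_sum => x _.
have xn : (x <= n)%N by rewrite -ltnS.
apply: ler_wpM2l; first by rewrite divr_ge0 //; case: (pf k) => ->.
case: ifP => x2; first by rewrite hQ // x2.
by rewrite subr0 mul1r ler_nat card_size_le.
Qed.

Lemma edge_prob_ge (R : realType) (n m : nat) (f : 'I_m -> nat -> R) k
  (Q : pred {set 'I_n}) (h : nat -> R) : is_profile n f ->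
  (forall A : {set 'I_n}, (#|A| <= 1)%N -> Q A) ->
  (forall x, (2 <= x <= n)%N ->
    (1 - h x) * 'C(n, x)%:R <= #|[pred A : {set 'I_n} | Q A & #|A| == x]|%:R) ->
  1 - \sum_(2 <= x < n.+1) h x * f k x <= \sum_(A | Q A) edge_prob f k A.
Proof.
move=> pf Q1 hQ; rewrite (profile_tailE k h pf) edge_probE; apply: ler_sum => x _.
have xn : (x <= n)%N by rewrite -ltnS.
apply: ler_wpM2l; first by rewrite divr_ge0 //; case: (pf k) => ->.
case: ifPn => x2; first by rewrite hQ // x2.
rewrite subr0 mul1r ler_nat card_size_ge // => A Ax.
by apply: Q1; rewrite Ax leqNgt.
Qed.

(** * Independent hyperedges and uncrossed sets *)

Definition hprob (R : realType) (n m : nat) (f : 'I_m -> nat -> R)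
  (V : {ffun 'I_m -> {set 'I_n}}) : R := \prod_(k < m) edge_prob f k (V k).

Lemma hprob_ge0 (R : realType) (n m : nat) (f : 'I_m -> nat -> R)
  (V : {ffun 'I_m -> {set 'I_n}}) : is_profile n f -> 0 <= hprob f V.
Proof. by move=> pf; apply: prodr_ge0 => k _; apply: edge_prob_ge0. Qed.

(** This is where independence enters: the sum of products over all choices of hyperedges
    factors. *)
Lemma hprob_forall (R : realType) (n m : nat) (f : 'I_m -> nat -> R)
  (Q : pred {set 'I_n}) :
  \sum_(V : {ffun 'I_m -> {set 'I_n}} | [forall k, Q (V k)]) hprob f V =
  \prod_(k < m) \sum_(A | Q A) edge_prob f k A.
Proof. by rewrite bigA_distr_big. Qed.

Lemma hprob_total (R : realType) (n m : nat) (f : 'I_m -> nat -> R) :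
  is_profile n f -> \sum_(V : {ffun 'I_m -> {set 'I_n}}) hprob f V = 1.
Proof.
move=> pf; transitivity (\sum_(V : {ffun 'I_m -> {set 'I_n}} | [forall k, xpredT (V k)]) hprob f V).
  by apply: eq_bigl => V; apply/esym/forallP.
rewrite (@hprob_forall R n m f xpredT) big1 // => k _.
(* With [h = 0] and the full predicate, the upper and lower bounds for one hyperedge are both 1. *)
have t0 : \sum_(2 <= x < n.+1) 0 * f k x = 0 by rewrite big1 // => x _; rewrite mul0r.
apply/le_anti/andP; split.
  have := @edge_prob_le R n m f k xpredT (fun=> 0) pf.
  rewrite t0 subr0; by apply=> x _; rewrite mul1r ler_nat card_size_le.
have := @edge_prob_ge R n m f k xpredT (fun=> 0) pf.
rewrite t0 subr0; by apply=> // x _; rewrite mul1r ler_nat card_size_ge.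
Qed.

Definition noncrossing (n : nat) (S A : {set 'I_n}) := (A \subset S) || (A \subset ~: S).

Lemma noncrossingN (n : nat) (S A : {set 'I_n}) :
  ~~ noncrossing S A = (A :&: S != finset.set0) && (A :&: ~: S != finset.set0).
Proof.
by rewrite negb_or andbC !setI_eq0 !finset.disjoints_subset finset.setCK.
Qed.

Lemma hconnectedPn (n m : nat) (V : {ffun 'I_m -> {set 'I_n}}) :
  reflect (exists S : {set 'I_n}, [/\ S != finset.set0, ~: S != finset.set0 &
             [forall k, noncrossing S (V k)]]) (~~ hconnected V).
Proof.
apply: (iffP idP) => [|[S [S0 S1 /forallP SV]]].
  rewrite negb_forall => /existsP[S]; rewrite negb_imply => /andP[/andP[S0 S1]].
  rewrite negb_exists => /forallP SV; exists S; split => //; apply/forallP => k.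
  by have := SV k; rewrite -noncrossingN negbK.
apply/negP => /forallP/(_ S); rewrite S0 S1 /= => /existsP[k].
by rewrite -noncrossingN SV.
Qed.

(** * Tail moments, the [S_r] of the idea above *)

Definition tail_moment (R : realType) (n m : nat) (f : 'I_m -> nat -> R) (r : nat) : R :=
  \sum_(k < m) \sum_(2 <= x < n.+1) x%:R ^+ r * f k x.

Lemma tail_momentE (R : realType) (n m : nat) (f : 'I_m -> nat -> R) (r : nat) :
  (0 < m)%N -> tail_moment n f r = m%:R * moment n f r.
Proof. by move=> m0; rewrite /moment mulrA divff ?mul1r // pnatr_eq0 -lt0n. Qed.

Lemma tail_moment_le (R : realType) (n m : nat) (f : 'I_m -> nat -> R) (g h : nat -> R) :
  is_profile n f -> (forall x, (2 <= x)%N -> g x <= h x) ->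
  \sum_(k < m) \sum_(2 <= x < n.+1) g x * f k x <=
  \sum_(k < m) \sum_(2 <= x < n.+1) h x * f k x.
Proof.
move=> pf gh; apply: ler_sum => k _; apply: ler_sum_nat => x /andP[x2 xn].
by rewrite ler_wpM2r ?gh //; case: (pf k) => ->.
Qed.

Lemma tail_moment_ge0 (R : realType) (n m : nat) (f : 'I_m -> nat -> R) (r : nat) :
  is_profile n f -> 0 <= tail_moment n f r.
Proof.
move=> pf; apply: le_trans (tail_moment_le pf (g := fun=> 0) _) => [|x _].
  by apply: sumr_ge0 => k _; apply: sumr_ge0 => x _; rewrite mul0r.
exact: exprn_ge0.
Qed.

Lemma tail_moment01 (R : realType) (n m : nat) (f : 'I_m -> nat -> R) :
  is_profile n f -> 2 * tail_moment n f 0 <= tail_moment n f 1.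
Proof.
move=> pf; rewrite /tail_moment mulr_sumr.
under eq_bigr => k _ do rewrite mulr_sumr; under eq_bigr => k _ do under eq_bigr => x _ do rewrite mulrA.
apply: (tail_moment_le pf (g := fun x => 2 * x%:R ^+ 0) (h := fun x => x%:R ^+ 1)) => x x2.
by rewrite expr0 expr1 mulr1 ler_nat.
Qed.

Lemma tail_moment12 (R : realType) (n m : nat) (f : 'I_m -> nat -> R) :
  is_profile n f -> tail_moment n f 1 <= tail_moment n f 2.
Proof.
move=> pf; apply: tail_moment_le => // x x2; rewrite expr1 expr2 -natrM ler_nat.
by rewrite leq_pmulr // ltnW.
Qed.

(** * The probability that no hyperedge crosses a given set *)

(** Independence gives a product over [k], and [1 - t <= exp (- t)] turns it into the exponential of
    a sum. *)
Lemma prob_noncrossing_le (R : realType) (n m : nat) (f : 'I_m -> nat -> R)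
  (S : {set 'I_n}) (h : nat -> R) : is_profile n f ->
  (forall x, (2 <= x <= n)%N ->
    'C(#|S|, x)%:R + 'C(n - #|S|, x)%:R <= (1 - h x) * 'C(n, x)%:R) ->
  \sum_(V : {ffun 'I_m -> {set 'I_n}} | [forall k, noncrossing S (V k)]) hprob f V <=
  expR (- \sum_(k < m) \sum_(2 <= x < n.+1) h x * f k x).
Proof.
move=> pf hS; rewrite hprob_forall -sumrN expR_sum; apply: ler_prod => k _.
rewrite sumr_ge0 /= => [|A _]; last exact: edge_prob_ge0.
apply: le_trans (expR_ge1Dx _); apply: edge_prob_le => // x xn.
by apply: le_trans (hS x xn); rewrite -natrD ler_nat card_noncrossing.
Qed.

(** Since [x >= 2], the term [y^x <= y^2] fits into the half of [x^2 y^2] that [onem_expr_le] leaves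
    over. *)
Lemma expr_onem_le (R : realType) (y : R) (x : nat) : 0 <= y <= 1 -> (2 <= x)%N ->
  y ^+ x + (1 - y) ^+ x <= 1 - (x%:R * y - x%:R ^+ 2 * y ^+ 2).
Proof.
move=> y01 x2; have := onem_expr_le x y01.
have y2 : y ^+ x <= y ^+ 2 by rewrite ler_wiXn2l //; case/andP: y01.
have : 2 * y ^+ 2 <= x%:R ^+ 2 * y ^+ 2.
  rewrite ler_wpM2r ?exprn_ge0 //; first by case/andP: y01.
  by rewrite -natrX ler_nat (leq_trans _ (leq_mul x2 x2)).
lra.
Qed.

(** The worst case is [x = 2], where [1 - 2 y + 2 y^2 <= 1 - y] because [y <= 1/2]. *)
Lemma expr_onem_le2 (R : realType) (y : R) (x : nat) : 0 <= y <= 2^-1 -> (2 <= x)%N ->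
  y ^+ x + (1 - y) ^+ x <= 1 - y.
Proof.
move=> /andP[y0 y1] x2.
have A : y ^+ x <= y ^+ 2 by rewrite ler_wiXn2l //; lra.
have B : (1 - y) ^+ x <= (1 - y) ^+ 2 by rewrite ler_wiXn2l //; lra.
apply: le_trans (lerD A B) _; nra.
Qed.

Lemma bin_sum_le (R : realType) (s n x : nat) : (0 < n)%N -> (s <= n)%N ->
  'C(s, x)%:R + 'C(n - s, x)%:R <=
  ((s%:R / n%:R) ^+ x + (1 - s%:R / n%:R) ^+ x) * 'C(n, x)%:R :> R.
Proof.
move=> n0 sn; rewrite mulrDl lerD ?bin_ratio_ler //.
apply: le_trans (bin_ratio_ler _ _ n0 (leq_subr s n)) _.
by rewrite natrB // mulrBl divff // pnatr_eq0 -lt0n.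
Qed.

Lemma prob_noncrossing_small (R : realType) (n m : nat) (f : 'I_m -> nat -> R)
  (S : {set 'I_n}) : (0 < n)%N -> is_profile n f ->
  \sum_(V : {ffun 'I_m -> {set 'I_n}} | [forall k, noncrossing S (V k)]) hprob f V <=
  expR (- (#|S|%:R / n%:R * tail_moment n f 1 -
           (#|S|%:R / n%:R) ^+ 2 * tail_moment n f 2)).
Proof.
move=> n0 pf; set y := #|S|%:R / n%:R.
have Sn : (#|S| <= n)%N by rewrite -[leqRHS]card_ord max_card.
have y01 : 0 <= y <= 1.
  by rewrite divr_ge0 //= ler_pdivrMr ?ltr0n // mul1r ler_nat.
have -> : y * tail_moment n f 1 - y ^+ 2 * tail_moment n f 2 =
  \sum_(k < m) \sum_(2 <= x < n.+1) (x%:R * y - x%:R ^+ 2 * y ^+ 2) * f k x.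
  rewrite /tail_moment !mulr_sumr -sumrB; apply: eq_bigr => k _.
  by rewrite !mulr_sumr -sumrB; apply: eq_bigr => x _; ring.
apply: prob_noncrossing_le => // x /andP[x2 xn].
apply: le_trans (bin_sum_le _ _ n0 Sn) _.
by rewrite ler_wpM2r // expr_onem_le.
Qed.

Lemma prob_noncrossing_large (R : realType) (n m : nat) (f : 'I_m -> nat -> R)
  (S : {set 'I_n}) : (0 < n)%N -> (2 * #|S| <= n)%N -> is_profile n f ->
  \sum_(V : {ffun 'I_m -> {set 'I_n}} | [forall k, noncrossing S (V k)]) hprob f V <=
  expR (- (#|S|%:R / n%:R * tail_moment n f 0)).
Proof.
move=> n0 S2 pf; set y := #|S|%:R / n%:R.
have Sn : (#|S| <= n)%N by rewrite -[leqRHS]card_ord max_card.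
have y01 : 0 <= y <= 2^-1.
  rewrite divr_ge0 //= ler_pdivrMr ?ltr0n //.
  have : 2 * #|S|%:R <= n%:R :> R by rewrite -natrM ler_nat.
  lra.
have -> : y * tail_moment n f 0 = \sum_(k < m) \sum_(2 <= x < n.+1) y * f k x.
  rewrite /tail_moment !mulr_sumr; apply: eq_bigr => k _.
  by rewrite !mulr_sumr; apply: eq_bigr => x _; rewrite expr0 mul1r.
apply: (@prob_noncrossing_le _ _ _ _ _ (fun=> y)) => // x /andP[x2 xn].
apply: le_trans (bin_sum_le _ _ n0 Sn) _.
by rewrite ler_wpM2r // expr_onem_le2.
Qed.

(** * Geometric decay in the size of the set *)

(** The bound [(e n / s)^s] in exponential form: ['C(n, s) <= n^s / s!] combined with
    [factorial_ge]. *)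
Lemma bin_le_expR (R : realType) (n s : nat) : (0 < n)%N -> (0 < s)%N ->
  'C(n, s)%:R <= expR (s%:R * (ln n%:R + 1 - ln s%:R)) :> R.
Proof.
move=> n0 s0; have n0' : 0 < n%:R :> R by rewrite ltr0n.
have s0' : 0 < s%:R :> R by rewrite ltr0n.
rewrite expRM_natl expRB expRD !lnK ?posrE // expr_div_n ler_pdivlMr ?exprn_gt0 //.
apply: le_trans (ler_wpM2l _ (factorial_ge R s)) _ => //.
rewrite mulrA exprMn ler_wpM2r ?exprn_ge0 ?expR_ge0 //.
rewrite -natrM bin_ffact -natrX ler_nat ffact_prod.
rewrite -[X in (_ <= _ ^ X)%N]card_ord -prod_nat_const; apply: leq_prod => i _.
exact: leq_subr.
Qed.

Lemma bin_le_expR_n (R : realType) (n s : nat) : 'C(n, s)%:R <= expR n%:R :> R.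
Proof.
have -> : expR n%:R = expR 1 ^+ n :> R by rewrite -expRM_natl mulr1.
have e2 : 2 <= expR 1 :> R by have := expR_ge1Dx (1 : R); lra.
apply: (@le_trans _ _ (2 ^+ n)); last by rewrite lerXn2r ?nnegrE ?expR_ge0.
rewrite -natrX ler_nat.
have [sn|sn] := leqP s n; last by rewrite bin_small.
rewrite -[2%N]/(1 + 1)%N expnDn (bigD1 (Ordinal (sn : (s < n.+1)%N))) //= !exp1n !muln1.
exact: leq_addr.
Qed.

Lemma expR_ge_half_sqr (R : realType) (x : R) : 0 <= x -> x ^+ 2 / 2 <= expR x.
Proof. by move=> x0; have := expR_ge1Dxn 1 x0; rewrite (_ : 2`! = 2)%N //; lra. Qed.

(** For small sets, the second-order term costs [(C y / 2) ln n] per node; the [ln s] gained in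
    [(e n / s)^s] pays for it. *)
Lemma ratio_ln_le (R : realType) (C : R) (n s : nat) : 1 <= C -> (0 < s)%N ->
  4 * C <= ln n%:R -> C * s%:R <= n%:R ->
  C * (s%:R / n%:R) * ln n%:R / 2 <= 1 + ln s%:R.
Proof.
move=> C1 s0 ln4 sn; set l := ln n%:R in ln4 *.
have l0 : 0 < l by lra.
have n0' : 0 < n%:R :> R.
  by rewrite ltr0n lt0n; apply/eqP => n0; move: l0; rewrite /l n0 ln0 ?ltxx.
have s1 : 0 <= ln s%:R :> R by rewrite ln_ge0 // ler1n.
have nE : n%:R = expR (l / 2) ^+ 2 :> R.
  by rewrite -expRM_natl mulrC divfK ?lnK ?posrE // pnatr_eq0.
set u := expR (l / 2) in nE.
have u0 : 0 < u by exact: expR_gt0.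
(* Up to s = sqrt n the left-hand side is at most 1, beyond it ln s >= (ln n) / 2. *)
have [su|us] := lerP s%:R u.
  have : s%:R / n%:R <= u^-1.
    by rewrite ler_pdivrMr // nE expr2 mulKf ?gt_eqF.
  have ul : l * C <= 2 * u.
    have := @expR_ge_half_sqr R (l / 2); rewrite -/u => /(_ ltac:(lra)).
    nra.
  move=> sn'.
  have : C * l * (s%:R / n%:R) <= C * l * u^-1 by rewrite ler_wpM2l // mulr_ge0; lra.
  have : C * l * u^-1 <= 2 by rewrite ler_pdivrMr // mulrC.
  lra.
have : l / 2 <= ln s%:R.
  by rewrite -(expRK (l / 2)) ler_ln ?posrE ?ltr0n // ltW.
have : C * (s%:R / n%:R) <= 1 by rewrite mulrA ler_pdivrMr // mul1r.
nra.
Qed.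

(** Dividing by the binomial makes all sets of size [s] together contribute at most [r^s]. Half of
    the margin [4 - 2 ln r] survives the factor [1 - C y / 2 >= 1/2]: its part [- ln r] yields
    [r^s], and its part 2 pays for the [e] in [(e n / s)^s] and the 1 in [ratio_ln_le]. *)
Lemma prob_noncrossing_geom (R : realType) (n m : nat) (f : 'I_m -> nat -> R)
  (S : {set 'I_n}) (C r : R) : is_profile n f -> 1 <= C -> 0 < r <= 1 ->
  tail_moment n f 2 <= C * tail_moment n f 0 ->
  ln n%:R + (4 - 2 * ln r) <= tail_moment n f 1 / n%:R ->
  4 * C <= ln n%:R -> C ^+ 2 * (1 - ln r) <= ln n%:R ->
  (0 < #|S|)%N -> (2 * #|S| <= n)%N ->
  \sum_(V : {ffun 'I_m -> {set 'I_n}} | [forall k, noncrossing S (V k)]) hprob f V <=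
  r ^+ #|S| / 'C(n, #|S|)%:R.
Proof.
move=> pf C1 /andP[r0 r1] m20 hL l4 lC s0 s2; set s := #|S| in s0 s2 *.
have n0 : (0 < n)%N by lia.
have sn : (s <= n)%N by lia.
have n0' : 0 < n%:R :> R by rewrite ltr0n.
have s0' : 1 <= s%:R :> R by rewrite ler1n.
have r0' : ln r <= 0 by rewrite ln_le0.
have m01 := tail_moment01 pf; have m12 := tail_moment12 pf.
set l := ln n%:R in hL l4 lC.
have rE : r ^+ s = expR (s%:R * ln r) by rewrite expRM_natl lnK.
rewrite ler_pdivlMr ?ltr0n ?bin_gt0 // rE.
set M0 := tail_moment n f 0 in m20 m01; set M1 := tail_moment n f 1 in m01 m12 hL.
set M2 := tail_moment n f 2 in m12 m20.
set y : R := s%:R / n%:R.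
have y0 : 0 < y by rewrite divr_gt0 //; lra.
have sy : s%:R = y * n%:R by rewrite /y divfK ?gt_eqF.
have [Cs|Cs] := lerP (C * s%:R) n%:R.
  apply: le_trans (ler_pM _ _ (prob_noncrossing_small S n0 pf) (bin_le_expR R n0 s0)) _ => //.
    by apply: sumr_ge0 => V _; apply: hprob_ge0.
  rewrite -expRD ler_expR -/s -/M1 -/M2 -/y -/l.
  have yl := ratio_ln_le C1 s0 l4 Cs; rewrite -/l -/y in yl.
  have Cy : C * y <= 1 by rewrite mulrA ler_pdivrMr // mul1r.
  set L := M1 / n%:R in hL.
  have yM : y * M1 = s%:R * L by rewrite /y /L mulrAC mulrA.
  (* From [M2 <= C M0 <= C M1 / 2]: the second-order term is a fraction [C y / 2] of the main term
     [s L]. *)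
  have : y ^+ 2 * M2 <= s%:R * (C * y / 2 * L).
    have -> : s%:R * (C * y / 2 * L) = y ^+ 2 * (C * (M1 / 2)).
      by rewrite mulrCA -yM; field.
    by rewrite ler_wpM2l ?sqr_ge0 //; apply: le_trans m20 _; rewrite ler_wpM2l; lra.
  suff : s%:R * (l + 1 - ln s%:R - L * (1 - C * y / 2)) <= s%:R * ln r by rewrite yM; lra.
  rewrite ler_wpM2l //.
  have : (l + (4 - 2 * ln r)) * (1 - C * y / 2) <= L * (1 - C * y / 2).
    by rewrite ler_wpM2r //; lra.
  have : (4 - 2 * ln r) * (1 / 2) <= (4 - 2 * ln r) * (1 - C * y / 2).
    by rewrite ler_wpM2l //; lra.
  lra.
apply: le_trans (ler_pM _ _ (prob_noncrossing_large n0 s2 pf) (bin_le_expR_n R n s)) _ => //.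
  by apply: sumr_ge0 => V _; apply: hprob_ge0.
rewrite -expRD ler_expR -/s -/M0 -/y.
have Cy : 1 <= C * y by rewrite mulrA ler_pdivlMr // mul1r ltW.
have nl : n%:R * l <= M1.
  by rewrite mulrC -ler_pdivlMr //; lra.
have M0l : n%:R * l <= C * M0 by lra.
have M00 : 0 <= M0 by exact: tail_moment_ge0.
(* After multiplication by [C^2], this follows from [C^2 (1 - ln r) <= l] and
   [n l <= M1 <= M2 <= C M0 <= C M0 (C y)]. *)
have H : n%:R * (1 - ln r) <= y * M0.
  rewrite -(ler_pM2l (_ : 0 < C ^+ 2)); last by rewrite exprn_gt0; lra.
  rewrite mulrCA; apply: (@le_trans _ _ (n%:R * l)); first by rewrite ler_wpM2l // ltW.
  apply: le_trans M0l _.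
  have -> : C ^+ 2 * (y * M0) = C * M0 * (C * y) by ring.
  by rewrite ler_peMr // mulr_ge0 //; lra.
have : n%:R * ln r <= s%:R * ln r by rewrite ler_wnM2r // ler_nat.
lra.
Qed.

(** * Union bound over sets of at most half the nodes *)

Lemma sum_geom_le (R : realType) (n : nat) (r : R) : 0 < r <= 2^-1 ->
  \sum_(x < n) r ^+ x.+1 <= 2 * r.
Proof.
move=> /andP[r0 r1].
(* The subtracted tail makes the induction close, using [2 r <= 1]. *)
suff : \sum_(x < n) r ^+ x.+1 <= 2 * r - 2 * r ^+ n.+1.
  by move=> /le_trans; apply; rewrite lerBlDr lerDl mulr_ge0 // exprn_ge0 // ltW.
elim: n => [|n IH]; first by rewrite big_ord0 expr1 subrr.
rewrite big_ord_recr /=; apply: le_trans (lerD IH (lexx _)) _.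
rewrite [r ^+ n.+2]exprS.
have : 0 <= r ^+ n.+1 by rewrite exprn_ge0 // ltW.
nra.
Qed.

Lemma prob_connectedE (R : realType) (n m : nat) (f : 'I_m -> nat -> R) :
  is_profile n f -> 1 - prob_connected n f =
  \sum_(V : {ffun 'I_m -> {set 'I_n}} | ~~ hconnected V) hprob f V.
Proof.
by move=> pf; rewrite -(hprob_total pf) (bigID (@hconnected n m)) /= addrAC subrr add0r.
Qed.

(** Crossing is symmetric under complement, and one of [S] and [~: S] has at most half of the
    nodes. *)
Lemma hconnectedN_small (n m : nat) (V : {ffun 'I_m -> {set 'I_n}}) :
  ~~ hconnected V -> exists2 S : {set 'I_n}, (0 < #|S|)%N && (2 * #|S| <= n)%N &
    [forall k, noncrossing S (V k)].
Proof.
move=> /hconnectedPn[S [S0 S1 SV]].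
have SC : (#|S| + #|~: S|)%N = n by rewrite cardsC card_ord.
have [S2|S2] := leqP (2 * #|S|) n; first by exists S => //; rewrite S2 card_gt0 S0.
exists (~: S).
  rewrite card_gt0 S1 -(leq_add2l (2 * #|S|)) -mulnDr SC mul2n -addnn leq_add2r.
  exact: ltnW.
by apply/forallP => k; rewrite /noncrossing finset.setCK orbC; apply: (forallP SV).
Qed.

Lemma prob_disconnected_le (R : realType) (n m : nat) (f : 'I_m -> nat -> R) (r : R) :
  is_profile n f -> 0 < r <= 2^-1 ->
  (forall S : {set 'I_n}, (0 < #|S|)%N -> (2 * #|S| <= n)%N ->
    \sum_(V : {ffun 'I_m -> {set 'I_n}} | [forall k, noncrossing S (V k)]) hprob f V <=
    r ^+ #|S| / 'C(n, #|S|)%:R) ->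
  1 - prob_connected n f <= 2 * r.
Proof.
move=> pf r01 hS; rewrite prob_connectedE //.
pose Q := [pred S : {set 'I_n} | (0 < #|S|)%N && (2 * #|S| <= n)%N].
apply: (@le_trans _ _ (\sum_(S | Q S)
    \sum_(V : {ffun 'I_m -> {set 'I_n}} | [forall k, noncrossing S (V k)]) hprob f V)).
  under [leRHS]eq_bigr => S _ do rewrite big_mkcond.
  rewrite exchange_big /= big_mkcond; apply: ler_sum => V _.
  have ge0 (S : {set 'I_n}) :
      0 <= if [forall k, noncrossing S (V k)] then hprob f V else 0.
    by case: ifP => // _; apply: hprob_ge0.
  case: ifP => [/hconnectedN_small[S QS SV]|_]; last by apply: sumr_ge0 => S _.
  by rewrite (bigD1 S) //= SV lerDl sumr_ge0.
apply: le_trans (ler_sum _ (fun S (QS : Q S) => hS S (proj1 (andP QS)) (proj2 (andP QS)))) _.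
rewrite (@sum_by_card R n Q (fun x => r ^+ x / 'C(n, x)%:R)).
apply: le_trans (sum_geom_le n r01); rewrite big_ord_recl /=.
(* The empty set is excluded by [Q], so the geometric series starts at [r] instead of 1. *)
have -> : #|[pred A : {set 'I_n} | Q A & #|A| == 0%N]| = 0%N.
  apply: eq_card0 => A; apply/negP; rewrite inE => /andP[/andP[A0 _] /eqP A1].
  by rewrite A1 in A0.
rewrite mulr0 add0r; apply: ler_sum => x _; rewrite /bump /= add1n.
have r0 : 0 <= r ^+ x.+1 by rewrite exprn_ge0 //; lra.
rewrite -mulrA ler_piMr // mulrC ler_pdivrMr ?ltr0n ?bin_gt0 // mul1r ler_nat.
exact: card_size_le.
Qed.

(** * Second moment method for isolated nodes *)

(** Chebyshev: on [Z] the squared deviation from the mean [mu] equals [mu^2], and the variance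
    dominates that part of its sum. No division, so [mu = 0] is allowed. *)
Lemma second_moment (R : realType) (T : finType) (w X : T -> R) (Z : pred T) :
  (forall t, 0 <= w t) -> \sum_t w t = 1 -> (forall t, Z t -> X t = 0) ->
  (\sum_(t | Z t) w t) * (\sum_t w t * X t) ^+ 2 <=
  \sum_t w t * X t ^+ 2 - (\sum_t w t * X t) ^+ 2.
Proof.
move=> w0 w1 XZ; have [mu muE] : exists mu, \sum_t w t * X t = mu by eexists.
rewrite muE.
have -> : \sum_t w t * X t ^+ 2 - mu ^+ 2 = \sum_t w t * (X t - mu) ^+ 2.
  transitivity (\sum_t w t * X t ^+ 2 - 2 * mu * \sum_t w t * X t + mu ^+ 2 * \sum_t w t).
    by rewrite w1 muE; ring.
  by rewrite !mulr_sumr -sumrB -big_split; apply: eq_bigr => t _ /=; ring.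
rewrite mulr_suml big_mkcond; apply: ler_sum => t _.
case: ifP => [/XZ ->|_]; first by rewrite sub0r sqrrN.
by rewrite mulr_ge0 // sqr_ge0.
Qed.

(** Isolated means joined to no other node; the hyperedge consisting of [v] alone is permitted. *)
Definition isolated_node (n m : nat) (v : 'I_n) (V : {ffun 'I_m -> {set 'I_n}}) :=
  [forall k, noncrossing [set v]%SET (V k)].

Lemma hconnected_isolated_node (n m : nat) (v : 'I_n) (V : {ffun 'I_m -> {set 'I_n}}) :
  (1 < n)%N -> hconnected V -> ~~ isolated_node v V.
Proof.
move=> n1 cV; apply/negP => iV; move: cV; apply/negP/hconnectedPn.
exists [set v]%SET; split => //; first by rewrite -card_gt0 cards1.
by rewrite -card_gt0 cardsCs finset.setCK cards1 card_ord subn_gt0.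
Qed.

Lemma noncrossing1 (n : nat) (v : 'I_n) (A : {set 'I_n}) : (1 < #|A|)%N ->
  noncrossing [set v]%SET A = (v \notin A).
Proof.
move=> A1; rewrite /noncrossing.
have -> /= : A \subset [set v]%SET = false.
  by apply/negP => /subset_leq_card; rewrite cards1 leqNgt A1.
by rewrite finset.subsetC finset.sub1set inE.
Qed.

Lemma noncrossing_card1 (n : nat) (S A : {set 'I_n}) : (#|A| <= 1)%N -> noncrossing S A.
Proof.
move=> /card_le1_eqP A1; apply: contraT; rewrite noncrossingN.
move=> /andP[/set0Pn[x /setIP[xA xS]] /set0Pn[y /setIP[yA]]].
by rewrite inE (A1 x y) ?xS.
Qed.

(** The sets of size [x] avoiding [v] number ['C(n.-1, x)], a fraction [1 - x / n] of all. *)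
Lemma prob_isolated_ge (R : realType) (n m : nat) (f : 'I_m -> nat -> R) (v : 'I_n) k :
  is_profile n f ->
  1 - \sum_(2 <= x < n.+1) x%:R / n%:R * f k x <=
  \sum_(A | noncrossing [set v]%SET A) edge_prob f k A.
Proof.
move=> pf; apply: edge_prob_ge => // [A A1|x /andP[x2 xn]]; first exact: noncrossing_card1.
have n0 : (0 < n)%N by apply: leq_trans xn; apply: leq_trans x2.
have n0' : n%:R != 0 :> R by rewrite pnatr_eq0 -lt0n.
apply: (@le_trans _ _ 'C(n.-1, x)%:R).
  rewrite -(ler_pM2l (_ : 0 < n%:R)) ?ltr0n // -natrM mul_bin_down natrM natrB //.
  by rewrite mulrA mulrBr mulr1 mulrCA divff // mulr1.
have -> : n.-1 = #|(~: [set v])%SET| by rewrite cardsCs finset.setCK cards1 card_ord subn1.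
rewrite ler_nat -cards_draws -cardsE; apply/subset_leq_card/fintype.subsetP => A.
rewrite !inE => /andP[Av /eqP Ax]; rewrite Ax eqxx andbT.
by rewrite /noncrossing Av orbT.
Qed.

(** For [x >= 2] a set must avoid both nodes, which leaves at most a fraction [(1 - 2 / n)^x];
    [onem_expr_le] at [y = 2 / n] gives the quadratic. *)
Lemma prob_isolated2_le (R : realType) (n m : nat) (f : 'I_m -> nat -> R) (u v : 'I_n) k :
  is_profile n f -> u != v ->
  \sum_(A | noncrossing [set u]%SET A && noncrossing [set v]%SET A) edge_prob f k A <=
  1 - 2 * \sum_(2 <= x < n.+1) x%:R / n%:R * f k x +
  2 * \sum_(2 <= x < n.+1) (x%:R / n%:R) ^+ 2 * f k x.
Proof.
move=> pf uv.
have -> : 1 - 2 * \sum_(2 <= x < n.+1) x%:R / n%:R * f k x +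
  2 * \sum_(2 <= x < n.+1) (x%:R / n%:R) ^+ 2 * f k x =
  1 - \sum_(2 <= x < n.+1) (2 * (x%:R / n%:R) - 2 * (x%:R / n%:R) ^+ 2) * f k x.
  rewrite !mulr_sumr -addrA; congr (1 + _); rewrite addrC -opprB -sumrB; congr (- _).
  by apply: eq_bigr => x _; ring.
apply: edge_prob_le => // x /andP[x2 xn].
have n2 : (2 <= n)%N by apply: leq_trans xn.
have n0 : (0 < n)%N by apply: leq_trans n2.
have n0' : n%:R != 0 :> R by rewrite pnatr_eq0 -lt0n.
apply: (@le_trans _ _ 'C(n - 2, x)%:R).
  have -> : (n - 2)%N = #|(~: [set u; v])%SET|.
    by rewrite cardsCs finset.setCK cards2 uv card_ord.
  rewrite ler_nat -cards_draws -[leqRHS]cardsE -cardsE.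
  apply/subset_leq_card/fintype.subsetP => A.
  rewrite !inE => /andP[/andP[Au Av] /eqP Ax]; rewrite Ax eqxx andbT.
  rewrite !noncrossing1 ?Ax // in Au Av.
  by rewrite finset.subsetC finset.subUset !finset.sub1set !inE Au Av.
apply: le_trans (bin_ratio_ler _ _ n0 (leq_subr 2 n)) _.
rewrite ler_wpM2r // natrB // mulrBl divff //.
apply: le_trans (onem_expr_le _ _) _.
  by rewrite divr_ge0 //= ler_pdivrMr ?ltr0n // mul1r ler_nat.
by rewrite le_eqVlt; apply/orP; left; apply/eqP; field.
Qed.

(** Jensen for a measure of mass at most 1, by expanding the sum of [(g x - a)^2 f k x]. *)
Lemma sqr_tail_mean_le (R : realType) (n m : nat) (f : 'I_m -> nat -> R) (g : nat -> R) k :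
  is_profile n f ->
  (\sum_(2 <= x < n.+1) g x * f k x) ^+ 2 <= \sum_(2 <= x < n.+1) g x ^+ 2 * f k x.
Proof.
move=> pf; have [a aE] : exists a, \sum_(2 <= x < n.+1) g x * f k x = a by eexists.
rewrite aE.
have f1 : \sum_(2 <= x < n.+1) f k x <= 1.
  case: (pf k) => f0 <-; rewrite big_tail; apply: ler_sum => x _.
  by case: ifP => // _; rewrite f0 // -ltnS.
have : 0 <= \sum_(2 <= x < n.+1) (g x - a) ^+ 2 * f k x.
  rewrite big_nat; apply: sumr_ge0 => x /andP[_ xn]; rewrite mulr_ge0 ?sqr_ge0 //.
  by case: (pf k) => ->.
have -> : \sum_(2 <= x < n.+1) (g x - a) ^+ 2 * f k x =
  \sum_(2 <= x < n.+1) g x ^+ 2 * f k x - 2 * a * a + a ^+ 2 * \sum_(2 <= x < n.+1) f k x.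
  by rewrite -{3}aE !mulr_sumr -sumrB -big_split; apply: eq_bigr => x _ /=; ring.
have : a ^+ 2 * \sum_(2 <= x < n.+1) f k x <= a ^+ 2 by rewrite ler_piMr ?sqr_ge0.
lra.
Qed.

(** Write [1 - a] as the inverse of [1 + a / (1 - a)], and use [a / (1 - a) <= a + 2 a^2] for
    [a <= 1/2]. *)
Lemma onem_ge_expR (R : realType) (a : R) : 0 <= a <= 2^-1 ->
  expR (- (a + 2 * a ^+ 2)) <= 1 - a.
Proof.
move=> /andP[a0 a1]; have b0 : 0 < 1 - a by lra.
apply: (@le_trans _ _ (expR (- (a / (1 - a))))).
  rewrite ler_expR lerN2 ler_pdivrMr //.
  have : 0 <= a ^+ 2 * (1 - 2 * a) by rewrite mulr_ge0 ?sqr_ge0 //; lra.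
  nra.
rewrite expRN -[leRHS]invrK lef_pV2 ?posrE ?expR_gt0 ?invr_gt0 //.
apply: le_trans (expR_ge1Dx _).
by rewrite le_eqVlt; apply/orP; left; apply/eqP; field; rewrite gt_eqF.
Qed.

Lemma hprob_isolated (R : realType) (n m : nat) (f : 'I_m -> nat -> R) (v : 'I_n) :
  \sum_(V : {ffun 'I_m -> {set 'I_n}}) hprob f V * (isolated_node v V)%:R =
  \prod_(k < m) \sum_(A | noncrossing [set v]%SET A) edge_prob f k A.
Proof.
rewrite -hprob_forall [RHS]big_mkcond; apply: eq_bigr => V _.
by rewrite /isolated_node; case: ifP => _; rewrite ?mulr1 ?mulr0.
Qed.

Lemma hprob_isolated2 (R : realType) (n m : nat) (f : 'I_m -> nat -> R) (u v : 'I_n) :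
  \sum_(V : {ffun 'I_m -> {set 'I_n}}) hprob f V * (isolated_node u V && isolated_node v V)%:R =
  \prod_(k < m)
    \sum_(A | noncrossing [set u]%SET A && noncrossing [set v]%SET A) edge_prob f k A.
Proof.
rewrite -(hprob_forall f (fun A => noncrossing [set u]%SET A && noncrossing [set v]%SET A)).
rewrite [RHS]big_mkcond; apply: eq_bigr => V _.
have -> : isolated_node u V && isolated_node v V =
    [forall k, noncrossing [set u]%SET (V k) && noncrossing [set v]%SET (V k)].
  apply/andP/forallP => [[/forallP uV /forallP vV] k|uvV]; first by rewrite uV vV.
  by split; apply/forallP => k; case/andP: (uvV k).
by case: ifP => _; rewrite ?mulr1 ?mulr0.
Qed.

(** The number [X] of isolated nodes vanishes on connected hypergraphs, has mean [mu >= n p], and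
    its second moment is at most [mu + n^2 r]; apply [second_moment] and divide by [mu^2]. *)
Lemma prob_connected_second_moment (R : realType) (n m : nat) (f : 'I_m -> nat -> R)
  (p r : R) : (1 < n)%N -> is_profile n f -> 0 < p ->
  (forall v : 'I_n,
    p <= \prod_(k < m) \sum_(A | noncrossing [set v]%SET A) edge_prob f k A) ->
  (forall u v : 'I_n, u != v ->
    \prod_(k < m)
      \sum_(A | noncrossing [set u]%SET A && noncrossing [set v]%SET A) edge_prob f k A
    <= r) ->
  0 <= r ->
  prob_connected n f <= (n%:R * p)^-1 + r / p ^+ 2 - 1.
Proof.
move=> n1 pf p0 hp hr r0.
pose X (V : {ffun 'I_m -> {set 'I_n}}) : R := \sum_v (isolated_node v V)%:R.
have XZ V : hconnected V -> X V = 0.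
  by move=> cV; apply: big1 => v _; rewrite (negbTE (hconnected_isolated_node v n1 cV)).
have n0 : 0 < n%:R :> R by rewrite ltr0n ltnW.
have w0 (V : {ffun 'I_m -> {set 'I_n}}) : 0 <= hprob f V by exact: hprob_ge0.
have := second_moment w0 (hprob_total pf) XZ.
have muE : \sum_V hprob f V * X V =
    \sum_(v < n) \prod_(k < m) \sum_(A | noncrossing [set v]%SET A) edge_prob f k A.
  under eq_bigr => V _ do rewrite mulr_sumr.
  by rewrite exchange_big; apply: eq_bigr => v _; apply: hprob_isolated.
have mu_ge : n%:R * p <= \sum_V hprob f V * X V.
  rewrite muE mulr_natl -[X in _ *+ X](card_ord n) -sumr_const.
  exact: ler_sum.
have X2 : \sum_V hprob f V * X V ^+ 2 <= \sum_V hprob f V * X V + n%:R ^+ 2 * r.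
  (* The square is a sum over ordered pairs: the diagonal gives the mean, every other pair at most
     [r]. *)
  have -> : \sum_V hprob f V * X V ^+ 2 = \sum_(u < n) \sum_(v < n)
      \sum_V hprob f V * (isolated_node u V && isolated_node v V)%:R.
    under [RHS]eq_bigr => u _ do rewrite exchange_big.
    rewrite [RHS]exchange_big; apply: eq_bigr => V _ /=.
    rewrite expr2 mulr_suml mulr_sumr; apply: eq_bigr => u _.
    by rewrite !mulr_sumr; apply: eq_bigr => v _; rewrite -natrM mulnb.
  have -> : n%:R ^+ 2 * r = \sum_(u < n) \sum_(v < n) r.
    by rewrite !sumr_const card_ord -mulrnA -[RHS]mulr_natl natrM expr2.
  rewrite muE -big_split; apply: ler_sum => u _ /=.
  rewrite [leLHS](bigD1 u) //= [\sum_(v < n) r](bigD1 u) //= lerD //.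
    rewrite hprob_isolated2 le_eqVlt; apply/orP; left; apply/eqP.
    by apply: eq_bigr => k _; apply: eq_bigl => A; rewrite andbb.
  rewrite -[leLHS]add0r lerD //; apply: ler_sum => v vu.
  by rewrite hprob_isolated2 hr // eq_sym.
rewrite -[\sum_(t | hconnected t) _]/(prob_connected n f).
move: mu_ge X2; set mu := \sum_V _ * X V; set e := \sum_V _ * X V ^+ 2 => mu_ge X2 H.
have np0 : 0 < n%:R * p by rewrite mulr_gt0.
have mu0 : 0 < mu by apply: lt_le_trans mu_ge.
apply: (@le_trans _ _ ((mu + n%:R ^+ 2 * r - mu ^+ 2) / mu ^+ 2)).
  by rewrite ler_pdivlMr ?exprn_gt0 //; lra.
have -> : (mu + n%:R ^+ 2 * r - mu ^+ 2) / mu ^+ 2 = mu^-1 + n%:R ^+ 2 * r / mu ^+ 2 - 1.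
  by field; rewrite gt_eqF.
have -> : r / p ^+ 2 = n%:R ^+ 2 * r / (n%:R * p) ^+ 2 by field; rewrite !gt_eqF.
rewrite lerD2r lerD ?lef_pV2 ?posrE //.
apply: ler_wpM2l; first by rewrite mulr_ge0 ?exprn_ge0.
by rewrite lef_pV2 ?posrE ?exprn_gt0 // lerXn2r ?nnegrE // ltW.
Qed.

(** The first term bounds the inverse of the mean number of isolated nodes, the second the excess
    correlation of two of them. *)
Lemma prob_connected_le (R : realType) (n m : nat) (f : 'I_m -> nat -> R) (d : R) :
  (1 < n)%N -> is_profile n f ->
  tail_moment n f 2 / n%:R ^+ 2 <= d -> d <= 4^-1 ->
  prob_connected n f <=
  expR (- (ln n%:R - tail_moment n f 1 / n%:R) + 2 * d) + (expR (8 * d) - 1).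
Proof.
move=> n1 pf Ed d4.
have n0 : 0 < n%:R :> R by rewrite ltr0n ltnW.
pose a k := \sum_(2 <= x < n.+1) x%:R / n%:R * f k x.
pose e k := \sum_(2 <= x < n.+1) (x%:R / n%:R) ^+ 2 * f k x.
have aS : \sum_k a k = tail_moment n f 1 / n%:R.
  rewrite mulr_suml; apply: eq_bigr => k _; rewrite mulr_suml.
  by apply: eq_bigr => x _; rewrite expr1 mulrAC.
have eS : \sum_k e k = tail_moment n f 2 / n%:R ^+ 2.
  rewrite mulr_suml; apply: eq_bigr => k _; rewrite mulr_suml.
  by apply: eq_bigr => x _; rewrite expr_div_n mulrAC.
have f0 k x : (x < n.+1)%N -> 0 <= f k x by case: (pf k) => f0 _; exact: f0.
have a0 k : 0 <= a k.
  rewrite /a big_nat; apply: sumr_ge0 => x /andP[_ xn].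
  by rewrite mulr_ge0 ?f0 ?divr_ge0.
have e0 k : 0 <= e k.
  rewrite /e big_nat; apply: sumr_ge0 => x /andP[_ xn].
  by rewrite mulr_ge0 ?f0 ?sqr_ge0.
have ae k : a k ^+ 2 <= e k by exact: sqr_tail_mean_le.
have ed k : e k <= d.
  apply: le_trans Ed; rewrite -eS (bigD1 k) //= lerDl; exact: sumr_ge0.
(* Here [d <= 1/4] is used: [a_k^2 <= e_k <= d]. *)
have a2 k : a k <= 2^-1.
  have := ae k; have := ed k; have := a0 k; nra.
pose p := \prod_k (1 - a k).
have p0 : 0 < p by apply: prodr_gt0 => k _; have := a2 k; lra.
have p_ge : expR (- (tail_moment n f 1 / n%:R + 2 * d)) <= p.
  apply: (@le_trans _ _ (expR (\sum_k - (a k + 2 * a k ^+ 2)))).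
    rewrite ler_expR sumrN lerN2 big_split /= aS lerD2l -mulr_sumr ler_wpM2l //.
    by apply: le_trans Ed; rewrite -eS ler_sum.
  rewrite expR_sum; apply: ler_prod => k _; rewrite expR_ge0 /=.
  by rewrite onem_ge_expR // a0 a2.
(* The 8 comes from [(1 - a_k)^2 >= 1/4], so that [8 e_k (1 - a_k)^2 >= 2 e_k]. *)
have r_le k : 1 - 2 * a k + 2 * e k <= (1 - a k) ^+ 2 * expR (8 * e k).
  apply: (@le_trans _ _ ((1 - a k) ^+ 2 * (1 + 8 * e k))).
    have : 2^-1 ^+ 2 <= (1 - a k) ^+ 2.
      by rewrite lerXn2r ?nnegrE //; have := a2 k; lra.
    have := e0 k; have := sqr_ge0 (a k); nra.
  by rewrite ler_wpM2l ?sqr_ge0 ?expR_ge1Dx.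
have H := @prob_connected_second_moment R n m f p (p ^+ 2 * expR (8 * d)) n1 pf p0.
apply: le_trans (H _ _ _) _.
- move=> v; apply: ler_prod => k _; rewrite prob_isolated_ge // andbT.
  by have := a2 k; rewrite /a; lra.
- move=> u v uv; apply: (@le_trans _ _ (\prod_k ((1 - a k) ^+ 2 * expR (8 * e k)))).
    apply: ler_prod => k _; rewrite sumr_ge0 /= => [|A _]; last exact: edge_prob_ge0.
    by apply: le_trans (r_le k); apply: prob_isolated2_le.
  rewrite big_split /= prodrXl ler_wpM2l ?sqr_ge0 // -expR_sum ler_expR -mulr_sumr.
  by rewrite ler_wpM2l // eS.
- by rewrite mulr_ge0 ?sqr_ge0 ?expR_ge0.
rewrite mulrAC divff ?mul1r ?sqrf_eq0 ?gt_eqF // -addrA lerD2r.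
have -> : - (ln n%:R - tail_moment n f 1 / n%:R) + 2 * d =
  - ln n%:R + (tail_moment n f 1 / n%:R + 2 * d) by ring.
rewrite expRD expRN lnK ?posrE // invfM; apply: ler_wpM2l; first by rewrite invr_ge0 ltW.
by rewrite -[leRHS]invrK lef_pV2 ?posrE ?invr_gt0 ?expR_gt0 // -expRN.
Qed.

(** * Passage to the limit *)

Local Open Scope classical_set_scope.
Local Open Scope ring_scope.

Lemma near_ln_ge (R : realType) (A : R) : \forall n \near \oo, A <= ln (n%:R : R).
Proof.
near=> n; have An : expR A <= n%:R by near: n; exact: nbhs_infty_ger.
by rewrite -(expRK A) ler_ln ?posrE ?expR_gt0 // (lt_le_trans (expR_gt0 A)).
Unshelve. all: by end_near.
Qed.

Lemma expR_le_1D2x (R : realType) (x : R) : 0 <= x <= 2^-1 -> expR x <= 1 + 2 * x.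
Proof.
move=> /andP[x0 x1]; rewrite -[leLHS]invrK -expRN invf_ple ?posrE ?expR_gt0 //; last lra.
apply: le_trans (expR_ge1Dx _); rewrite -[leLHS]mul1r ler_pdivrMr; last lra.
have : 0 <= x * (1 - 2 * x) by rewrite mulr_ge0; lra.
lra.
Qed.

Lemma prob_connected_ge0 (R : realType) (n m : nat) (f : 'I_m -> nat -> R) :
  is_profile n f -> 0 <= prob_connected n f.
Proof. by move=> pf; apply: sumr_ge0 => V _; apply: hprob_ge0. Qed.

Lemma prob_connected_le1 (R : realType) (n m : nat) (f : 'I_m -> nat -> R) :
  is_profile n f -> prob_connected n f <= 1.
Proof.
move=> pf; rewrite -subr_ge0 prob_connectedE //.
by apply: sumr_ge0 => V _; apply: hprob_ge0.
Qed.

(** The constant is raised to at least 1, as the estimates above require. *)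
Lemma tail_moment_bound (R : realType) (n m : nat) (f : 'I_m -> nat -> R) (C : R) :
  (0 < m)%N -> is_profile n f -> moment n f 2 <= C * `|moment n f 0| ->
  tail_moment n f 2 <= Num.max C 1 * tail_moment n f 0.
Proof.
move=> m0 pf; have := tail_moment_ge0 0 pf; rewrite !tail_momentE //.
have m0' : 0 < m%:R :> R by rewrite ltr0n.
rewrite pmulr_rge0 // => M0; rewrite ger0_norm // => H.
rewrite [leRHS]mulrCA ler_pM2l //; apply: le_trans H _.
by rewrite ler_wpM2r // le_max lexx.
Qed.

Lemma prob_connected_cvg0 (R : realType) (m : nat -> nat)
  (f : forall n : nat, 'I_(m n) -> nat -> R) (C : R) : 1 <= C ->
  (forall n, is_profile n (f n)) ->
  (\forall n \near \oo, tail_moment n (f n) 2 <= C * tail_moment n (f n) 0) ->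
  (forall A, \forall n \near \oo, A <= ln (n%:R : R) - tail_moment n (f n) 1 / n%:R) ->
  forall eps : R, 0 < eps -> \forall n \near \oo, prob_connected n (f n) <= eps.
Proof.
(* The first bound gives [8 d <= 1/2], needed in [expR_le_1D2x]; the second makes
   [exp (8 d) - 1 <= 16 d <= eps / 2]. *)
move=> C1 pf hC hL eps eps0; pose d := Num.min (16^-1) (eps / 32).
have d0 : 0 < d by rewrite lt_min; apply/andP; split; lra.
have d1 : d <= 16^-1 by rewrite ge_min lexx.
have d2 : d <= eps / 32 by rewrite ge_min lexx orbT.
near=> n.
have n1 : (1 < n)%N by near: n; exact: nbhs_infty_gt.
have n0 : 0 < n%:R :> R by rewrite ltr0n ltnW.
have L1 : 2 * d - ln (eps / 2) <= ln (n%:R : R) - tail_moment n (f n) 1 / n%:R.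
  by near: n; exact: hL.
have L0 : 0 <= ln (n%:R : R) - tail_moment n (f n) 1 / n%:R by near: n; exact: hL.
have l1 : Num.max 1 (2 * C / d) <= ln (n%:R : R) by near: n; exact: near_ln_ge.
have S20 : tail_moment n (f n) 2 <= C * tail_moment n (f n) 0 by near: n.
move: L1 L0 l1; rewrite ge_max; set l := ln n%:R; set L := _ / n%:R => L1 L0 /andP[l1 l2].
(* Here [S_2 <= C S_0 <= C S_1 <= C l n], and [C l <= d l^2 / 2 <= d n]. *)
have S2d : tail_moment n (f n) 2 / n%:R ^+ 2 <= d.
  rewrite ler_pdivrMr ?exprn_gt0 //; apply: le_trans S20 _.
  have nl : tail_moment n (f n) 1 <= l * n%:R by rewrite -ler_pdivrMr // -/L; lra.
  have S01 := tail_moment01 (pf n); have S0 := tail_moment_ge0 0 (pf n).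
  have ll : l ^+ 2 / 2 <= n%:R.
    have := @expR_ge_half_sqr R l; rewrite lnK ?posrE //; apply; lra.
  have Cdl : 2 * C <= l * d by rewrite -ler_pdivrMr.
  apply: (@le_trans _ _ (C * (l * n%:R))); first by rewrite ler_wpM2l //; lra.
  rewrite expr2 !mulrA ler_pM2r //.
  have : 2 * C * l <= l * d * l by rewrite ler_wpM2r //; lra.
  have : d * (l ^+ 2 / 2) <= d * n%:R by rewrite ler_wpM2l // ltW.
  lra.
apply: le_trans (prob_connected_le n1 (pf n) S2d _) _; first lra.
have e8 : expR (8 * d) <= 1 + 2 * (8 * d) by apply: expR_le_1D2x; lra.
have : expR (- (ln n%:R - tail_moment n (f n) 1 / n%:R) + 2 * d) <= eps / 2.
  rewrite -[leRHS]lnK ?posrE ?divr_gt0 // ler_expR -/l -/L; lra.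
lra.
Unshelve. all: by end_near.
Qed.

Lemma prob_connected_cvg1 (R : realType) (m : nat -> nat)
  (f : forall n : nat, 'I_(m n) -> nat -> R) (C : R) : 1 <= C ->
  (forall n, is_profile n (f n)) ->
  (\forall n \near \oo, tail_moment n (f n) 2 <= C * tail_moment n (f n) 0) ->
  (forall A, \forall n \near \oo, ln (n%:R : R) - tail_moment n (f n) 1 / n%:R <= A) ->
  forall eps : R, 0 < eps -> \forall n \near \oo, 1 - prob_connected n (f n) <= eps.
Proof.
(* The bound 1/2 controls the geometric series; its sum is then at most [2 r <= eps]. *)
move=> C1 pf hC hL eps eps0; pose r := Num.min (2^-1) (eps / 2).
have r0 : 0 < r by rewrite lt_min; apply/andP; split; lra.
have r1 : r <= 2^-1 by rewrite ge_min lexx.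
have r2 : r <= eps / 2 by rewrite ge_min lexx orbT.
near=> n.
have L1 : ln (n%:R : R) - tail_moment n (f n) 1 / n%:R <= - (4 - 2 * ln r).
  by near: n; exact: hL.
have l1 : Num.max (4 * C) (C ^+ 2 * (1 - ln r)) <= ln (n%:R : R).
  by near: n; exact: near_ln_ge.
have S20 : tail_moment n (f n) 2 <= C * tail_moment n (f n) 0 by near: n.
move: l1; rewrite ge_max => /andP[l1 l2].
apply: (@le_trans _ _ (2 * r)); last lra.
apply: prob_disconnected_le => // [|S S0 S2]; first by rewrite r0.
apply: (@prob_noncrossing_geom _ _ _ _ _ C) => //; last lra.
by rewrite r0 /=; lra.
Unshelve. all: by end_near.
Qed.

Unset Implicit Arguments.
Theorem mainTheorem5 (R : realType) (m : nat -> nat)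
  (f : forall n : nat, 'I_(m n) -> nat -> R) :
  (forall n, (1 <= m n)%N) ->
  (forall n, is_profile n (f n)) ->
  (* (F)_2 <~ (F)_0 *)
  (exists C : R, \forall n \near \oo,
       moment n (f n) 2 <= C * `|moment n (f n) 0|) ->
  ((fun n : nat => ln (n%:R : R) - (m n)%:R / n%:R * moment n (f n) 1) @ \oo --> +oo ->
     (fun n : nat => prob_connected n (f n) : R) @ \oo --> (0 : R)) /\
  ((fun n : nat => ln (n%:R : R) - (m n)%:R / n%:R * moment n (f n) 1) @ \oo --> -oo ->
     (fun n : nat => prob_connected n (f n) : R) @ \oo --> (1 : R)).
Proof.
move=> m0 pf [C hC].
have C1 : 1 <= Num.max C 1 by rewrite le_max lexx orbT.
have hC' : \forall n \near \oo,
    tail_moment n (f n) 2 <= Num.max C 1 * tail_moment n (f n) 0.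
  by apply: filterS hC => n; apply: tail_moment_bound.
have LE n : (m n)%:R / n%:R * moment n (f n) 1 = tail_moment n (f n) 1 / n%:R.
  by rewrite tail_momentE // mulrAC.
split => [/cvgryPge|/cvgrNyPle] hL; apply/cvgrPdist_le => eps eps0.
  have hL' A : \forall n \near \oo, A <= ln (n%:R : R) - tail_moment n (f n) 1 / n%:R.
    by apply: filterS (hL A) => n; rewrite LE.
  apply: filterS (prob_connected_cvg0 C1 pf hC' hL' eps0) => n.
  by rewrite sub0r normrN ger0_norm // prob_connected_ge0.
have hL' A : \forall n \near \oo, ln (n%:R : R) - tail_moment n (f n) 1 / n%:R <= A.
  by apply: filterS (hL A) => n; rewrite LE.
apply: filterS (prob_connected_cvg1 C1 pf hC' hL' eps0) => n.
by rewrite ger0_norm // subr_ge0 prob_connected_le1.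
Qed.
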